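(* If $f$ is a Rogers function which is not identically zero and $\xi\in\mathbf{C}$ with $\operatorname{Re}\xi>0$, then $$\left|\frac{\xi f'(\xi)}{f(\xi)}\right|\le4(1+\sqrt2)\left(1-\frac{|\operatorname{Im}\xi|}{|\xi|}\right)^{-1}\left(\frac{|\xi|}{\operatorname{Re}\xi}\right).$$
   Context: A Rogers function is a holomorphic function $f$ on $\{\xi\in\mathbf{C}:\operatorname{Re}\xi>0\}$ with $\operatorname{Re}(f(\xi)/\xi)\ge0$ there. A Rogers function which is not identically zero has no zeros. *)

(* Defs.v *)
From Stdlib Require Import Reals.
From Coquelicot Require Import Coquelicot.

Open Scope R_scope.

(* A function on the right half-plane is a total [f : C -> C] whose values
   off the half-plane are irrelevant: the half-plane is open, so complex
   differentiability at one of its points and [C_derive] there are local.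
   Coquelicot defines [C_derive] as a limit along the real direction; at a
   point of complex differentiability it is the derivative
   ([C_derive_correct]). *)
Definition right_half_plane (z : C) : Prop := 0 < Re z.

Definition holomorphic_on (D : C -> Prop) (f : C -> C) : Prop :=
  forall z : C, D z -> @ex_derive C_AbsRing C_NormedModule f z.

Definition rogers_function (f : C -> C) : Prop :=
  holomorphic_on right_half_plane f /\
  forall xi : C, right_half_plane xi -> 0 <= Re (f xi / xi)%C.

(* Main.v *)
Require Import Defs.
From Stdlib Require Import Reals Lra Lia FunctionalExtensionality.
From Coquelicot Require Import Coquelicot.

Open Scope R_scope.

(* For [c > 0] the Cayley transform [h = (f/z - c) / (f/z + c)] of the function
   [f/z], whose real part is nonnegative, has modulus at most 1.  Cauchy's
   estimate [|h'(xi)| <= 2 / r] on the disc of radius [r = Re xi / 2], with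
   [c = |f xi / xi|], gives [|xi f'(xi) / f(xi)| <= 1 + 8 |xi| / Re xi], and
   [9 <= 4 (1 + sqrt 2)].  As only pointwise differentiability is assumed,
   Cauchy's estimate goes through Goursat's bisection argument, run in
   logarithmic polar coordinates [a + exp (s + i t)]: a square whose side is a
   multiple of [2 PI] has cancelling horizontal sides, so circular means of a
   function holomorphic in a punctured disc do not depend on the radius. *)

(** * Nested intervals and the bisection of squares *)

Lemma nested_intervals (x v : nat -> R) :
  (forall n, 0 <= v n) -> (forall n, x n <= x (S n)) ->
  (forall n, x (S n) + v (S n) <= x n + v n) ->
  exists X, forall n, x n <= X <= x n + v n.
Proof.
  intros Hv Hx Hxv.
  assert (up : forall n m, x n <= x (n + m)%nat).
  { intros n m; induction m as [|m IH]; [rewrite Nat.add_0_r; lra|].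
    rewrite Nat.add_succ_r; specialize (Hx (n + m)%nat); lra. }
  assert (down : forall n m, x (n + m)%nat + v (n + m)%nat <= x n + v n).
  { intros n m; induction m as [|m IH]; [rewrite Nat.add_0_r; lra|].
    rewrite Nat.add_succ_r; specialize (Hxv (n + m)%nat); lra. }
  assert (cross : forall n m, x n <= x m + v m).
  { intros n m; specialize (up n m); specialize (down m n).
    rewrite Nat.add_comm in down; specialize (Hv (n + m)%nat); lra. }
  (* The supremum of the left endpoints serves as the common point, because by [cross] each right
     endpoint is an upper bound for them. *)
  destruct (completeness (fun r => exists n, r = x n)) as [X [ub lub]].
  - exists (x 0%nat + v 0%nat); intros r [n ->]; apply cross.
  - exists (x 0%nat); now exists 0%nat.
  - exists X; intros n; split.
    + apply ub; now exists n.
    + apply lub; intros r [m ->]; apply cross.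
Qed.

Lemma half_pow_lt (w d : R) : 0 < d -> exists n, w * (/ 2) ^ n < d.
Proof.
  intros Hd.
  assert (H2 : Rabs (/ 2) < 1) by (rewrite Rabs_pos_eq; lra).
  assert (Hw : 0 < Rabs w + 1) by (pose proof (Rabs_pos w); lra).
  destruct (pow_lt_1_zero (/ 2) H2 (d / (Rabs w + 1))) as [n Hn].
  { now apply Rdiv_lt_0_compat. }
  exists n; specialize (Hn n (Nat.le_refl n)).
  assert (Hp : 0 < (/ 2) ^ n) by (apply pow_lt; lra).
  rewrite Rabs_pos_eq in Hn by lra.
  apply (Rmult_lt_compat_r (Rabs w + 1)) in Hn; [|lra].
  unfold Rdiv in Hn; rewrite Rmult_assoc, Rinv_l, Rmult_1_r in Hn by lra.
  pose proof (Rle_abs w); nra.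
Qed.

(* [E x y v] is a quantity attached to the square [x, x+v] x [y, y+v]. *)
Lemma additive_square_function_zero (E : R -> R -> R -> R) (A a b w : R) :
  (forall x y v, 0 <= v -> x + v <= A ->
     E x y v = E x y (v / 2) + E (x + v / 2) y (v / 2)
               + E x (y + v / 2) (v / 2) + E (x + v / 2) (y + v / 2) (v / 2)) ->
  (forall X Y, X <= A -> forall eps, 0 < eps -> exists delta, 0 < delta /\
     forall x y v, 0 < v < delta -> x <= X <= x + v -> y <= Y <= y + v ->
       x + v <= A -> Rabs (E x y v) <= eps * v ^ 2) ->
  0 < w -> a + w <= A -> E a b w = 0.
Proof.
  intros Hadd Hloc Hw HA.
  destruct (Req_dec (E a b w) 0) as [|Hne]; [assumption | exfalso].
  (* [eta] is the density of [E], its absolute value per unit area, on the initial square. The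
     bisection keeps this density from falling below [eta]. *)
  set (eta := Rabs (E a b w) / w ^ 2).
  assert (Hw2 : 0 < w ^ 2) by (apply pow_lt; lra).
  assert (Heta : 0 < eta) by (apply Rdiv_lt_0_compat; [now apply Rabs_pos_lt | lra]).
  set (big := fun x y v => eta * v ^ 2 <= Rabs (E x y v)).
  (* Here [v] is the side of the quarters. The first quarter of density at least [eta] is chosen,
     and the fourth one by default. *)
  set (step := fun (p : R * R) (v : R) => let (x, y) := p in
    if Rle_dec (eta * v ^ 2) (Rabs (E x y v)) then (x, y)
    else if Rle_dec (eta * v ^ 2) (Rabs (E (x + v) y v)) then (x + v, y)
    else if Rle_dec (eta * v ^ 2) (Rabs (E x (y + v) v)) then (x, y + v)
    else (x + v, y + v)).
  assert (Hstep : forall x y v, 0 <= v -> x + 2 * v <= A -> big x y (2 * v) ->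
    let p := step (x, y) v in
    big (fst p) (snd p) v /\ (x <= fst p <= x + v) /\ (y <= snd p <= y + v)).
  { intros x y v Hv HxA Hbig p; unfold p, step.
    destruct (Rle_dec _ _) as [H1|H1]; [simpl; repeat split; try exact H1; lra|].
    destruct (Rle_dec _ _) as [H2|H2]; [simpl; repeat split; try exact H2; lra|].
    destruct (Rle_dec _ _) as [H3|H3]; [simpl; repeat split; try exact H3; lra|].
    (* Three quarters below [eta * v ^ 2] leave at least that much for the fourth: the four values
       sum to at least [eta * (2 * v) ^ 2] in modulus. *)
    simpl; repeat split; try lra.
    unfold big in *; rewrite (Hadd x y (2 * v)) in Hbig by lra.
    replace (2 * v / 2) with v in Hbig by lra.
    set (e1 := E x y v) in *; set (e2 := E (x + v) y v) in *;
    set (e3 := E x (y + v) v) in *; set (e4 := E (x + v) (y + v) v) in *.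
    pose proof (Rabs_triang (e1 + e2 + e3) e4); pose proof (Rabs_triang (e1 + e2) e3);
    pose proof (Rabs_triang e1 e2); nra. }
  set (side := fun n => w * (/ 2) ^ n).
  set (sq := fix sq n := match n with O => (a, b) | S n => step (sq n) (side (S n)) end).
  assert (Hside : forall n, side n = 2 * side (S n)) by (intros n; unfold side; simpl; field).
  assert (Hpos : forall n, 0 < side n).
  { intros n; apply Rmult_lt_0_compat; [lra | apply pow_lt; lra]. }
  assert (Hinv : forall n, big (fst (sq n)) (snd (sq n)) (side n) /\ fst (sq n) + side n <= A).
  { induction n as [|n [IHb IHA]].
    - simpl; unfold big, side, eta; simpl; rewrite !Rmult_1_r; split; [|lra].
      right; field; lra.
    - rewrite Hside in IHb, IHA. specialize (Hpos (S n)).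
      destruct (Hstep (fst (sq n)) (snd (sq n)) (side (S n))) as [H1 [H2 H3]]; try lra; [assumption|].
      rewrite <- surjective_pairing in *. change (sq (S n)) with (step (sq n) (side (S n))).
      split; [assumption | lra]. }
  assert (Hnest : forall n, (fst (sq n) <= fst (sq (S n)) <= fst (sq n) + side (S n)) /\
                            (snd (sq n) <= snd (sq (S n)) <= snd (sq n) + side (S n))).
  { intros n; destruct (Hinv n) as [IHb IHA]. rewrite Hside in IHb, IHA. specialize (Hpos (S n)).
    destruct (Hstep (fst (sq n)) (snd (sq n)) (side (S n))) as [H1 [H2 H3]]; try lra; [assumption|].
    rewrite <- surjective_pairing in *. change (sq (S n)) with (step (sq n) (side (S n))).
    now split. }
  destruct (nested_intervals (fun n => fst (sq n)) side) as [X HX].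
  { intros n; specialize (Hpos n); lra. }
  { intros n; apply (Hnest n). }
  { intros n; destruct (Hnest n) as [H _]; rewrite (Hside n); lra. }
  destruct (nested_intervals (fun n => snd (sq n)) side) as [Y HY].
  { intros n; specialize (Hpos n); lra. }
  { intros n; apply (Hnest n). }
  { intros n; destruct (Hnest n) as [_ H]; rewrite (Hside n); lra. }
  (* All squares contain [(X, Y)]. Near it the density is at most [eta / 2], while it stays at least
     [eta] along the sequence. *)
  destruct (Hloc X Y) with (eps := eta / 2) as [delta [Hd HE]]; [|lra|].
  { specialize (HX 0%nat); destruct (Hinv 0%nat); lra. }
  destruct (half_pow_lt w delta Hd) as [n Hn]; fold (side n) in Hn.
  destruct (Hinv n) as [Hb HAn].
  specialize (HE (fst (sq n)) (snd (sq n)) (side n) (conj (Hpos n) Hn) (HX n) (HY n) HAn).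
  unfold big in Hb.
  assert (0 < side n ^ 2) by (apply pow_lt, Hpos). nra.
Qed.

(** * Integrals around squares and Goursat's lemma *)

Lemma RInt_diff_approx (f g : R -> R) (x v c M : R) :
  0 <= v -> ex_RInt f x (x + v) -> ex_RInt g x (x + v) ->
  (forall s, x <= s <= x + v -> Rabs (f s - g s - c) <= M) ->
  Rabs (RInt f x (x + v) - RInt g x (x + v) - v * c) <= v * M.
Proof.
  intros Hv Hf Hg HM.
  replace (v * M) with ((x + v - x) * M) by ring.
  apply (norm_RInt_le_const (V := R_NormedModule) (fun s => f s - g s - c)); [lra | exact HM |].
  replace (v * c) with ((x + v - x) * c) by ring.
  apply (is_RInt_minus (V := R_NormedModule) (fun s => f s - g s) (fun _ => c)).
  - apply (is_RInt_minus (V := R_NormedModule)); now apply (RInt_correct (V := R_CompleteNormedModule)).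
  - apply (is_RInt_const (V := R_NormedModule)).
Qed.

Lemma continuity_2d_pt_continuous_l (p : R -> R -> R) (x y : R) :
  continuity_2d_pt p x y -> continuous (fun s => p s y) x.
Proof.
  intros Hc; apply (continuous_comp_2 (fun s => s) (fun _ => y) p).
  - apply continuous_id.
  - apply continuous_const.
  - now apply continuity_2d_pt_filterlim.
Qed.

Lemma continuity_2d_pt_continuous_r (p : R -> R -> R) (x y : R) :
  continuity_2d_pt p x y -> continuous (fun t => p x t) y.
Proof.
  intros Hc; apply (continuous_comp_2 (fun _ => x) (fun t => t) p).
  - apply continuous_const.
  - apply continuous_id.
  - now apply continuity_2d_pt_filterlim.
Qed.

Lemma ex_RInt_horizontal (p : R -> R -> R) (A a b y : R) :
  (forall x, x <= A -> continuity_2d_pt p x y) ->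
  a <= A -> b <= A -> ex_RInt (fun s => p s y) a b.
Proof.
  intros Hc Ha Hb; apply (ex_RInt_continuous (V := R_CompleteNormedModule)); intros z [_ Hz].
  apply continuity_2d_pt_continuous_l, Hc.
  pose proof (Rmax_lub _ _ _ Ha Hb); lra.
Qed.

Lemma ex_RInt_vertical (q : R -> R -> R) (x a b : R) :
  (forall y, continuity_2d_pt q x y) -> ex_RInt (fun t => q x t) a b.
Proof.
  intros Hc; apply (ex_RInt_continuous (V := R_CompleteNormedModule)); intros z _.
  apply continuity_2d_pt_continuous_r, Hc.
Qed.

(** This is the line integral of the form [p ds + q dt] counterclockwise around the boundary of the
    square. *)
Definition loop_integral (p q : R -> R -> R) (x y v : R) : R :=
  RInt (fun s => p s y) x (x + v) - RInt (fun s => p s (y + v)) x (x + v)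
  + (RInt (fun t => q (x + v) t) y (y + v) - RInt (fun t => q x t) y (y + v)).

Lemma loop_integral_subdivide (p q : R -> R -> R) (A x y v : R) :
  (forall x y, x <= A -> continuity_2d_pt p x y) ->
  (forall x y, x <= A -> continuity_2d_pt q x y) ->
  0 <= v -> x + v <= A ->
  loop_integral p q x y v =
    loop_integral p q x y (v / 2) + loop_integral p q (x + v / 2) y (v / 2)
    + loop_integral p q x (y + v / 2) (v / 2)
    + loop_integral p q (x + v / 2) (y + v / 2) (v / 2).
Proof.
  intros Hp Hq Hv HA; unfold loop_integral.
  replace (x + v / 2 + v / 2) with (x + v) by field.
  replace (y + v / 2 + v / 2) with (y + v) by field.
  assert (Hh : forall t, RInt (fun s => p s t) x (x + v) =
    RInt (fun s => p s t) x (x + v / 2) + RInt (fun s => p s t) (x + v / 2) (x + v)).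
  { intros t; symmetry; apply (RInt_Chasles (V := R_CompleteNormedModule));
    apply ex_RInt_horizontal with A; try (intros; now apply Hp); lra. }
  assert (Hw : forall s, s <= A -> RInt (fun t => q s t) y (y + v) =
    RInt (fun t => q s t) y (y + v / 2) + RInt (fun t => q s t) (y + v / 2) (y + v)).
  { intros t Ht; symmetry; apply (RInt_Chasles (V := R_CompleteNormedModule));
    apply ex_RInt_vertical; intros; now apply Hq. }
  rewrite !Hh, !Hw by lra; ring.
Qed.

(* The linear parts of [p] and [q] contribute [(qx - py) v^2 = 0], so only the
   remainders of the first-order expansions survive. *)
Lemma loop_integral_small (p q : R -> R -> R) (A X Y px c qy : R) :
  (forall x y, x <= A -> continuity_2d_pt p x y) ->
  (forall x y, x <= A -> continuity_2d_pt q x y) ->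
  differentiable_pt_lim p X Y px c -> differentiable_pt_lim q X Y c qy ->
  forall eps, 0 < eps -> exists delta, 0 < delta /\
    forall x y v, 0 < v < delta -> x <= X <= x + v -> y <= Y <= y + v ->
      x + v <= A -> Rabs (loop_integral p q x y v) <= eps * v ^ 2.
Proof.
  intros Hp Hq Dp Dq eps Heps.
  (* Each of the four sides has length [v] and contributes a remainder of at most
     [eps / 4 * v ^ 2]. *)
  assert (He4 : 0 < eps / 4) by lra.
  destruct (Dp (mkposreal _ He4)) as [d1 H1]; destruct (Dq (mkposreal _ He4)) as [d2 H2].
  simpl in H1, H2.
  exists (Rmin d1 d2); split; [apply Rmin_pos; apply cond_pos|].
  intros x y v [Hv0 Hv] HX HY HA.
  pose proof (Rmin_l d1 d2); pose proof (Rmin_r d1 d2).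
  assert (near : forall s t, x <= s <= x + v -> y <= t <= y + v ->
    Rabs (s - X) <= v /\ Rabs (t - Y) <= v) by (intros; split; apply Rabs_le; lra).
  assert (Ep : forall s t, x <= s <= x + v -> y <= t <= y + v ->
    Rabs (p s t - p X Y - (px * (s - X) + c * (t - Y))) <= eps / 4 * v).
  { intros s t Hs Ht; destruct (near s t Hs Ht) as [N1 N2].
    eapply Rle_trans; [apply H1; lra|].
    apply Rmult_le_compat_l; [lra | now apply Rmax_lub]. }
  assert (Eq : forall s t, x <= s <= x + v -> y <= t <= y + v ->
    Rabs (q s t - q X Y - (c * (s - X) + qy * (t - Y))) <= eps / 4 * v).
  { intros s t Hs Ht; destruct (near s t Hs Ht) as [N1 N2].
    eapply Rle_trans; [apply H2; lra|].
    apply Rmult_le_compat_l; [lra | now apply Rmax_lub]. }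
  (* Between opposite sides the linear parts differ by a constant: [- c * v] for the horizontal
     pair, [c * v] for the vertical pair in [Iv]. These cancel in the sum. *)
  assert (Ih : Rabs (RInt (fun s => p s y) x (x + v) - RInt (fun s => p s (y + v)) x (x + v)
                     - v * (- c * v)) <= v * (eps / 2 * v)).
  { apply RInt_diff_approx; [lra | | |].
    1, 2: apply ex_RInt_horizontal with A; try (intros; now apply Hp); lra.
    intros s Hs.
    assert (E1 := Ep s y Hs ltac:(lra)); assert (E2 := Ep s (y + v) Hs ltac:(lra)).
    apply Rabs_le; apply Rabs_le_between in E1, E2; lra. }
  assert (Iv : Rabs (RInt (fun t => q (x + v) t) y (y + v) - RInt (fun t => q x t) y (y + v)
                     - v * (c * v)) <= v * (eps / 2 * v)).
  { apply RInt_diff_approx; [lra | | |].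
    1, 2: apply ex_RInt_vertical; intros; apply Hq; lra.
    intros t Ht.
    assert (E1 := Eq x t ltac:(lra) Ht); assert (E2 := Eq (x + v) t ltac:(lra) Ht).
    apply Rabs_le; apply Rabs_le_between in E1, E2; lra. }
  unfold loop_integral.
  apply Rabs_le; apply Rabs_le_between in Ih, Iv. nra.
Qed.

(** The shared [c] expresses that the form [p ds + q dt] is closed, with differentiability only
    pointwise. The loop integral is additive under bisection and small compared with the area near
    each point, so it vanishes. In logarithmic polar coordinates the half-plane [x <= A] covers a
    punctured disc. *)
Lemma goursat (p q : R -> R -> R) (A : R) :
  (forall x y, x <= A -> exists px c qy,
     differentiable_pt_lim p x y px c /\ differentiable_pt_lim q x y c qy) ->
  forall a b w, 0 < w -> a + w <= A -> loop_integral p q a b w = 0.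
Proof.
  intros HD a b w Hw HA.
  assert (Hp : forall x y, x <= A -> continuity_2d_pt p x y).
  { intros x y Hx; destruct (HD x y Hx) as (px & c & qy & Dp & _).
    apply differentiable_continuity_pt; now exists px, c. }
  assert (Hq : forall x y, x <= A -> continuity_2d_pt q x y).
  { intros x y Hx; destruct (HD x y Hx) as (px & c & qy & _ & Dq).
    apply differentiable_continuity_pt; now exists c, qy. }
  apply additive_square_function_zero with A; try assumption.
  - intros; now apply loop_integral_subdivide with A.
  - intros X Y HX; destruct (HD X Y HX) as (px & c & qy & Dp & Dq).
    now apply loop_integral_small with px c qy.
Qed.

(** * Rules for complex derivatives *)

Local Notation C_is_derive f z l := (@is_derive C_AbsRing C_NormedModule f z l).

Lemma C_is_derive_eps (f : C -> C) (z l : C) :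
  C_is_derive f z l <->
  forall eps, 0 < eps -> exists delta, 0 < delta /\
    forall w, Cmod (w - z) < delta ->
      Cmod (f w - f z - (w - z) * l) <= eps * Cmod (w - z).
Proof.
  split.
  - intros [_ H] eps Heps.
    destruct (H z (fun P HP => HP) (mkposreal eps Heps)) as [d Hd].
    exists d; split; [apply cond_pos|]; intros w Hw; exact (Hd w Hw).
  - intros H; split; [apply is_linear_scal_l|].
    intros x Hx. rewrite <- (is_filter_lim_locally_unique (V := AbsRing_NormedModule C_AbsRing) z x Hx).
    intros eps; destruct (H eps (cond_pos eps)) as (d & Hd & Hb).
    exists (mkposreal d Hd); intros w Hw; exact (Hb w Hw).
Qed.

(* Coquelicot puts two distinct normed-module structures on [C]; the product
   and chain rules are only available for the one below. *)
Lemma C_is_derive_AbsRing (f : C -> C) (z l : C) :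
  C_is_derive f z l <->
  @is_derive C_AbsRing (AbsRing_NormedModule C_AbsRing) f z l.
Proof.
  split; intros [_ H]; (split; [apply is_linear_scal_l | exact H]).
Qed.

Lemma C_is_derive_minus (f g : C -> C) (z df dg : C) :
  C_is_derive f z df -> C_is_derive g z dg ->
  C_is_derive (fun w => f w - g w)%C z (df - dg)%C.
Proof. intros Hf Hg; exact (is_derive_minus (K := C_AbsRing) (V := C_NormedModule) f g z df dg Hf Hg). Qed.

Lemma C_is_derive_plus (f g : C -> C) (z df dg : C) :
  C_is_derive f z df -> C_is_derive g z dg ->
  C_is_derive (fun w => f w + g w)%C z (df + dg)%C.
Proof. intros Hf Hg; exact (is_derive_plus (K := C_AbsRing) (V := C_NormedModule) f g z df dg Hf Hg). Qed.

Lemma C_is_derive_mult (f g : C -> C) (z df dg : C) :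
  C_is_derive f z df -> C_is_derive g z dg ->
  C_is_derive (fun w => f w * g w)%C z (df * g z + f z * dg)%C.
Proof.
  rewrite !C_is_derive_AbsRing; intros Hf Hg.
  exact (is_derive_mult (K := C_AbsRing) f g z df dg Hf Hg Cmult_comm).
Qed.

Lemma C_is_derive_const (c z : C) : C_is_derive (fun _ => c) z (RtoC 0).
Proof. exact (is_derive_const (K := C_AbsRing) (V := C_NormedModule) c z). Qed.

Lemma C_is_derive_id (z : C) : C_is_derive (fun w => w) z (RtoC 1).
Proof. apply C_is_derive_AbsRing; exact (is_derive_id (K := C_AbsRing) z). Qed.

Lemma C_is_derive_scal (c z : C) (f : C -> C) (d : C) :
  C_is_derive f z d -> C_is_derive (fun w => c * f w)%C z (c * d)%C.
Proof.
  intros Hd; replace (c * d)%C with (0 * f z + c * d)%C by ring.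
  apply (C_is_derive_mult (fun _ => c) f); [apply C_is_derive_const | assumption].
Qed.

Lemma C_is_derive_inv (z : C) : z <> 0 -> C_is_derive Cinv z (- / (z * z))%C.
Proof.
  intros Hz; apply C_is_derive_eps; intros eps Heps.
  assert (Hm : 0 < Cmod z) by now apply Cmod_gt_0.
  set (m := Cmod z) in *.
  (* The remainder is [(w - z)^2 / (z^2 w)]. The first bound keeps the modulus of [w] at least
     [m / 2], so that the remainder is at most [2 / m ^ 3] times the squared distance; the second
     turns this into [eps] times the distance. *)
  exists (Rmin (m / 2) (eps * m ^ 3 / 2)); split.
  { apply Rmin_pos; [lra|]. assert (0 < m ^ 3) by now apply pow_lt. nra. }
  intros w Hw.
  pose proof (Rmin_l (m / 2) (eps * m ^ 3 / 2)); pose proof (Rmin_r (m / 2) (eps * m ^ 3 / 2)).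
  assert (Hwm : m / 2 <= Cmod w).
  { pose proof (Cmod_triangle w (z - w)%C).
    replace (w + (z - w))%C with z in * by ring. fold m in H1.
    rewrite <- (Cmod_opp (z - w)) in H1. replace (- (z - w))%C with (w - z)%C in * by ring. lra. }
  assert (Hw0 : w <> 0).
  { intros ->; rewrite Cmod_0 in Hwm; lra. }
  replace (/ w - / z - (w - z) * - / (z * z))%C
    with ((w - z) * ((w - z) * (/ (z * z) * / w)))%C by (field; now split).
  rewrite !Cmod_mult, !Cmod_inv, Cmod_mult by (try apply Cmult_neq_0; assumption).
  fold m.
  set (d := Cmod (w - z)) in *.
  assert (0 <= d) by apply Cmod_ge_0.
  rewrite (Rmult_comm eps); apply Rmult_le_compat_l; [assumption|].
  assert (/ Cmod w <= / (m / 2)) by (apply Rinv_le_contravar; lra).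
  assert (Hi : 0 < / (m * m)) by (apply Rinv_0_lt_compat; nra).
  apply Rle_trans with (d * (/ (m * m) * / (m / 2))).
  { apply Rmult_le_compat_l; [assumption|]. apply Rmult_le_compat_l; lra. }
  apply Rle_trans with (eps * m ^ 3 / 2 * (/ (m * m) * / (m / 2))).
  { apply Rmult_le_compat_r; [|lra]. apply Rmult_le_pos; [lra|].
    left; apply Rinv_0_lt_compat; lra. }
  right; field; lra.
Qed.

Lemma C_is_derive_div (f g : C -> C) (z df dg : C) :
  g z <> 0 -> C_is_derive f z df -> C_is_derive g z dg ->
  C_is_derive (fun w => f w / g w)%C z ((df * g z - f z * dg) / (g z * g z))%C.
Proof.
  intros Hgz Hf Hg.
  replace ((df * g z - f z * dg) / (g z * g z))%C
    with (df * / g z + f z * (dg * - / (g z * g z)))%C by (field; assumption).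
  apply (C_is_derive_mult f (fun w => / g w)%C); [assumption|].
  exact (is_derive_comp (K := C_AbsRing) (V := C_NormedModule) Cinv g z _ _ (C_is_derive_inv _ Hgz)
           (proj1 (C_is_derive_AbsRing g z dg) Hg)).
Qed.

(** * Cauchy-Riemann equations and logarithmic polar coordinates *)

Lemma Cmod_le_2_Rmax (x y : R) : Cmod (x, y) <= 2 * Rmax (Rabs x) (Rabs y).
Proof.
  pose proof (Rmax_l (Rabs x) (Rabs y)); pose proof (Rmax_r (Rabs x) (Rabs y)).
  replace (x, y) with (RtoC x + Ci * RtoC y)%C by (apply injective_projections; simpl; ring).
  eapply Rle_trans; [apply Cmod_triangle|].
  rewrite Cmod_mult, !Cmod_R.
  replace (Cmod Ci) with 1; [lra|].
  transitivity (sqrt 1); [symmetry; apply sqrt_1 | unfold Cmod; f_equal; simpl; ring].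
Qed.

Lemma Rabs_Im_le_Cmod (z : C) : Rabs (Im z) <= Cmod z.
Proof. eapply Rle_trans; [apply Rmax_r | apply Rmax_Cmod]. Qed.

Lemma Rabs_Re_le_Cmod (z : C) : Rabs (Re z) <= Cmod z.
Proof. eapply Rle_trans; [apply Rmax_l | apply Rmax_Cmod]. Qed.

(** These are the Cauchy-Riemann equations: multiplication by [l] is written as a real linear map of
    the plane. The remainder is converted from the modulus to the maximum norm at the cost of a
    factor 2. *)
Lemma C_is_derive_Re_Im (f : C -> C) (x y : R) (l : C) :
  C_is_derive f (x, y) l ->
  differentiable_pt_lim (fun u v => Re (f (u, v))) x y (Re l) (- Im l) /\
  differentiable_pt_lim (fun u v => Im (f (u, v))) x y (Im l) (Re l).
Proof.
  intros H.
  assert (K : forall eps : posreal, locally_2d (fun u v =>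
    Cmod (f (u, v) - f (x, y) - ((u, v) - (x, y)) * l)
      <= eps * Rmax (Rabs (u - x)) (Rabs (v - y))) x y).
  { intros eps.
    destruct (proj1 (C_is_derive_eps f (x, y) l) H (eps / 2)) as (d & Hd & Hb).
    { pose proof (cond_pos eps); lra. }
    exists (mkposreal (d / 2) ltac:(lra)); simpl; intros u v Hu Hv.
    change ((u, v) - (x, y))%C with ((u - x, v - y) : C) in *.
    pose proof (Cmod_le_2_Rmax (u - x) (v - y)) as Hc.
    eapply Rle_trans; [apply Hb|].
    - change ((u, v) - (x, y))%C with ((u - x, v - y) : C).
      assert (Rmax (Rabs (u - x)) (Rabs (v - y)) < d / 2) by now apply Rmax_lub_lt.
      lra.
    - change ((u, v) - (x, y))%C with ((u - x, v - y) : C).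
      pose proof (cond_pos eps); nra. }
  split; intros eps; destruct (K eps) as [d Hd]; exists d; intros u v Hu Hv;
    (eapply Rle_trans; [|exact (Hd u v Hu Hv)]).
  - eapply Rle_trans; [|apply Rabs_Re_le_Cmod]; right; f_equal.
    unfold Re, Im; simpl; ring.
  - eapply Rle_trans; [|apply Rabs_Im_le_Cmod]; right; f_equal.
    unfold Re, Im; simpl; ring.
Qed.

Definition polar (a : C) (s t : R) : C := (Re a + exp s * cos t, Im a + exp s * sin t).

Lemma Cmod_polar_minus (a : C) (s t : R) : Cmod (polar a s t - a) = exp s.
Proof.
  unfold Cmod, polar, Re, Im; simpl.
  replace (_ + _) with (exp s * exp s * (Rsqr (sin t) + Rsqr (cos t))) by (unfold Rsqr; ring).
  rewrite sin2_cos2, Rmult_1_r; apply sqrt_square; left; apply exp_pos.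
Qed.

Lemma polar_differentiable (a : C) (s t : R) :
  differentiable_pt_lim (fun s t => Re (polar a s t)) s t (exp s * cos t) (- (exp s * sin t)) /\
  differentiable_pt_lim (fun s t => Im (polar a s t)) s t (exp s * sin t) (exp s * cos t).
Proof.
  assert (M : forall (c : R) (g : R -> R) dg, is_derive g t dg ->
    differentiable_pt_lim (fun u v => c + exp u * g v) s t (exp s * g t) (exp s * dg)).
  { intros c g dg Hg.
    apply filterdiff_differentiable_pt_lim.
    evar_last.
    - apply (filterdiff_plus_fct (U := prod_NormedModule _ R_NormedModule R_NormedModule)
               (fun _ => c) (fun u => exp (fst u) * g (snd u))).
      + apply filterdiff_const.
      + apply (filterdiff_mult_fct (U := prod_NormedModule _ R_NormedModule R_NormedModule)
                 (fun u => exp (fst u)) (fun u => g (snd u)) (s, t)).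
        * exact Rmult_comm.
        * apply (filterdiff_comp' (fst : R * R -> R) exp).
          { apply filterdiff_linear, is_linear_fst. }
          { apply is_derive_exp. }
        * apply (filterdiff_comp' (snd : R * R -> R) g).
          { apply filterdiff_linear, is_linear_snd. }
          { exact Hg. }
    - simpl; unfold plus, zero, mult, scal; simpl; unfold mult; simpl.
      apply functional_extensionality; intros u; ring. }
  split; unfold polar; simpl.
  - evar_last; [apply M, is_derive_cos | ring].
  - apply M, is_derive_sin.
Qed.

(** With [z = polar a s t] one has [dz / (z - a) = ds + i dt], so [Im G ds + Re G dt] is the
    imaginary part of [G dz / (z - a)]. The common [c] comes from the Cauchy-Riemann equations for
    [G (a + exp (s + i t))]. *)
Lemma polar_comp_differentiable (G : C -> C) (a : C) (s t : R) (l : C) :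
  C_is_derive G (polar a s t) l ->
  exists px c qy,
    differentiable_pt_lim (fun s t => Im (G (polar a s t))) s t px c /\
    differentiable_pt_lim (fun s t => Re (G (polar a s t))) s t c qy.
Proof.
  intros HG; destruct (C_is_derive_Re_Im G _ _ l HG) as [HRe HIm].
  destruct (polar_differentiable a s t) as [HX HY].
  pose proof (differentiable_pt_lim_comp _ _ _ s t _ _ _ _ _ _ HIm HX HY) as Dp.
  pose proof (differentiable_pt_lim_comp _ _ _ s t _ _ _ _ _ _ HRe HX HY) as Dq.
  exists (Im l * (exp s * cos t) + Re l * (exp s * sin t)).
  exists (Im l * - (exp s * sin t) + Re l * (exp s * cos t)).
  exists (Re l * - (exp s * sin t) + - Im l * (exp s * cos t)).
  split; [exact Dp|].
  replace (Im l * - (exp s * sin t) + Re l * (exp s * cos t))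
    with (Re l * (exp s * cos t) + - Im l * (exp s * sin t)) by ring.
  exact Dq.
Qed.

Lemma polar_period (a : C) (s : R) (n : nat) : polar a s (2 * INR n * PI) = polar a s 0.
Proof.
  unfold polar; rewrite <- (Rplus_0_l (2 * INR n * PI)); now rewrite cos_period, sin_period.
Qed.

(** * Circular means and Cauchy's estimate *)

(** The integrals run over [n] turns and are not normalised. Since the domain is a square, [n] turns
    go with a shrinking of the radius by the factor [exp (- w)]; a large [n] reaches circles as
    small as desired. *)
Lemma circular_mean_eq (G : C -> C) (a : C) (A : R) (n : nat) :
  (forall z, 0 < Cmod (z - a) <= exp A -> exists l, C_is_derive G z l) ->
  (0 < n)%nat ->
  let w := 2 * INR n * PI in
  RInt (fun t => Re (G (polar a A t))) 0 w
  = RInt (fun t => Re (G (polar a (A - w) t))) 0 w /\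
  forall s, s <= A -> ex_RInt (fun t => Re (G (polar a s t))) 0 w.
Proof.
  intros HG Hn w.
  assert (HD : forall s t, s <= A -> exists px c qy,
    differentiable_pt_lim (fun s t => Im (G (polar a s t))) s t px c /\
    differentiable_pt_lim (fun s t => Re (G (polar a s t))) s t c qy).
  { intros s t Hs; destruct (HG (polar a s t)) as [l Hl].
    - rewrite Cmod_polar_minus; split; [apply exp_pos|].
      destruct (Rle_lt_or_eq_dec _ _ Hs) as [Hlt| ->]; [left; now apply exp_increasing | lra].
    - now apply polar_comp_differentiable with l. }
  assert (Hw : 0 < w).
  { unfold w; pose proof PI_RGT_0; apply lt_0_INR in Hn; nra. }
  split.
  - pose proof (goursat _ _ A HD (A - w) 0 w Hw ltac:(lra)) as H.
    unfold loop_integral in H.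
    replace (A - w + w) with A in H by ring; rewrite Rplus_0_l in H.
    rewrite (RInt_ext (fun s => Im (G (polar a s w))) (fun s => Im (G (polar a s 0)))) in H.
    + lra.
    + intros s _; unfold w; now rewrite polar_period.
  - intros s Hs; apply (ex_RInt_vertical (fun s t => Re (G (polar a s t)))).
    intros t; destruct (HD s t Hs) as (px & c & qy & _ & Dq).
    apply differentiable_continuity_pt; now exists c, qy.
Qed.

(* [Re f'(a)] is the common circular mean of the real part of the difference
   quotient [(f z - f a) / (z - a)] over small circles around [a]. *)
Lemma cauchy_estimate_Re (f : C -> C) (a l : C) (r M : R) :
  0 < r ->
  (forall z, Cmod (z - a) <= r -> @ex_derive C_AbsRing C_NormedModule f z) ->
  C_is_derive f a l ->
  (forall z, Cmod (z - a) = r -> Cmod (f z - f a) <= M) ->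
  Re l <= M / r.
Proof.
  intros Hr Hf Hl HM; apply le_epsilon; intros eps Heps.
  set (G := fun z => ((f z - f a) / (z - a))%C).
  assert (HG : forall z, 0 < Cmod (z - a) <= exp (ln r) -> exists d, C_is_derive G z d).
  { intros z [Hz0 Hz]; rewrite exp_ln in Hz by assumption.
    destruct (Hf z Hz) as [d Hd].
    eexists; apply (C_is_derive_div (fun z => f z - f a)%C (fun z => z - a)%C).
    - now apply Cmod_gt_0.
    - apply C_is_derive_minus; [exact Hd | apply C_is_derive_const].
    - apply C_is_derive_minus; [apply C_is_derive_id | apply C_is_derive_const]. }
  assert (Hnear : exists delta, 0 < delta /\ forall z, 0 < Cmod (z - a) < delta ->
    Re l - eps <= Re (G z)).
  { destruct (proj1 (C_is_derive_eps f a l) Hl eps Heps) as (delta & Hd & Hb).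
    exists delta; split; [assumption|]; intros z [Hz0 Hz]; specialize (Hb z Hz).
    assert (Hne : (z - a)%C <> 0) by now apply Cmod_gt_0.
    replace (f z - f a - (z - a) * l)%C with ((G z - l) * (z - a))%C in Hb
      by (unfold G; field; assumption).
    rewrite Cmod_mult in Hb; apply Rmult_le_reg_r in Hb; [|assumption].
    pose proof (Rabs_Re_le_Cmod (G z - l)) as HRe.
    assert (E : Re (G z - l) = Re (G z) - Re l) by reflexivity.
    rewrite E in HRe. assert (HA := Rle_trans _ _ _ HRe Hb).
    apply Rabs_le_between in HA; lra. }
  destruct Hnear as (delta & Hd & Hnear).
  (* The inner radius is [r * exp (- w)], which must lie below [delta]. The successor in [n] keeps
     [w] positive even when [delta] exceeds [r]. *)
  destruct (INR_unbounded (ln r - ln delta)) as [n0 Hn0].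
  set (n := S n0).
  destruct (circular_mean_eq G a (ln r) n HG ltac:(unfold n; lia)) as [Heq Hex].
  set (w := 2 * INR n * PI) in *.
  assert (Hw : ln r - ln delta < w /\ 0 < w).
  { pose proof PI2_1; unfold w, n; rewrite S_INR; pose proof (pos_INR n0).
    split; nra. }
  assert (Hup : RInt (fun t => Re (G (polar a (ln r) t))) 0 w <= (w - 0) * (M / r)).
  { replace ((w - 0) * (M / r)) with (RInt (fun _ => M / r) 0 w) by exact (RInt_const 0 w (M / r)).
    apply RInt_le; [lra | apply Hex; lra | apply ex_RInt_const |].
    intros t _.
    assert (Hc : Cmod (polar a (ln r) t - a) = r) by (rewrite Cmod_polar_minus; now apply exp_ln).
    eapply Rle_trans; [apply Rle_abs|]; eapply Rle_trans; [apply Rabs_Re_le_Cmod|].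
    unfold G; rewrite Cmod_div, Hc.
    - apply Rmult_le_compat_r; [left; now apply Rinv_0_lt_compat | now apply HM].
    - apply Cmod_gt_0; lra. }
  assert (Hlow : (w - 0) * (Re l - eps) <= RInt (fun t => Re (G (polar a (ln r - w) t))) 0 w).
  { replace ((w - 0) * (Re l - eps)) with (RInt (fun _ => Re l - eps) 0 w) by exact (RInt_const 0 w (Re l - eps)).
    apply RInt_le; [lra | apply ex_RInt_const | apply Hex; lra |].
    intros t _; apply Hnear; rewrite Cmod_polar_minus; split; [apply exp_pos|].
    rewrite <- (exp_ln delta) by assumption; apply exp_increasing; lra. }
  rewrite Heq in Hup.
  assert (Re l - eps <= M / r); [|lra].
  apply Rmult_le_reg_l with (w - 0); lra.
Qed.

(** A rotation reduces this to real parts: [Cconj l * f] has at [a] the nonnegative real derivative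
    [Cmod l ^ 2], and its increments are bounded by [Cmod l * M]. *)
Lemma cauchy_estimate (f : C -> C) (a l : C) (r M : R) :
  0 < r ->
  (forall z, Cmod (z - a) <= r -> @ex_derive C_AbsRing C_NormedModule f z) ->
  C_is_derive f a l ->
  (forall z, Cmod (z - a) = r -> Cmod (f z - f a) <= M) ->
  Cmod l <= M / r.
Proof.
  intros Hr Hf Hl HM.
  destruct (Ceq_dec l 0) as [E|Hne].
  - rewrite E, Cmod_0; subst l.
    (* Here the estimate for real parts reads [0 <= M / r]. *)
    exact (cauchy_estimate_Re f a 0 r M Hr Hf Hl HM).
  - assert (Hpos : 0 < Cmod l) by now apply Cmod_gt_0.
    assert (H : Re (Cconj l * l)%C <= Cmod l * M / r).
    { apply (cauchy_estimate_Re (fun z => Cconj l * f z)%C a); try assumption.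
      - intros z Hz; destruct (Hf z Hz) as [d Hd]; exists (Cconj l * d)%C; now apply C_is_derive_scal.
      - now apply C_is_derive_scal.
      - intros z Hz.
        replace (Cconj l * f z - Cconj l * f a)%C with (Cconj l * (f z - f a))%C by ring.
        rewrite Cmod_mult, Cmod_conj.
        apply Rmult_le_compat_l; [lra | now apply HM]. }
    assert (E : Re (Cconj l * l)%C = Cmod l * Cmod l).
    { unfold Cmod; rewrite sqrt_sqrt by nra; unfold Re; simpl; ring. }
    rewrite E in H; unfold Rdiv in *; rewrite Rmult_assoc in H.
    now apply Rmult_le_reg_l in H.
Qed.

(** * The Cayley transform and the bound for Rogers functions *)

Lemma Cmod_minus_le_plus (q : C) (c : R) :
  0 <= c -> 0 <= Re q -> Cmod (q - c) <= Cmod (q + c).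
Proof.
  intros Hc Hq; apply sqrt_le_1_alt; unfold Re in Hq; simpl; nra.
Qed.

Lemma Cdiv_minus_plus_le_1 (q : C) (c : R) :
  0 < c -> 0 <= Re q -> Cmod ((q - c) / (q + c)) <= 1 /\ (q + c)%C <> 0.
Proof.
  intros Hc Hq.
  assert (Hne : (q + c)%C <> 0).
  { intros H; apply (f_equal Re) in H; unfold Re in *; simpl in H; lra. }
  split; [|assumption].
  assert (Hpos : 0 < Cmod (q + c)) by now apply Cmod_gt_0.
  rewrite Cmod_div by assumption.
  apply Rmult_le_reg_r with (Cmod (q + c)); [assumption|].
  unfold Rdiv; rewrite Rmult_assoc, Rinv_l by lra; rewrite Rmult_1_l, Rmult_1_r.
  apply Cmod_minus_le_plus; lra.
Qed.

(** The left side arises from [h' = 2 c (xi f' - f) / (f + c xi)^2]. Cauchy's estimate bounds [h']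
    by [4 / Re xi], and the denominator is at most [4 * Cmod (f xi) ^ 2] in modulus. *)
Lemma rogers_derivative_bound (f : C -> C) (xi df : C) :
  rogers_function f -> right_half_plane xi -> f xi <> 0 -> C_is_derive f xi df ->
  Cmod (xi * df - f xi) <= 8 * Cmod (f xi) * (Cmod xi / Re xi).
Proof.
  intros [Hhol Hre] Hxi Hf Hdf; unfold right_half_plane in *.
  assert (nz : forall z, 0 < Re z -> z <> 0) by (intros z Hz ->; simpl in Hz; lra).
  assert (Hm : 0 < Cmod xi) by (apply Cmod_gt_0; auto).
  assert (HF : 0 < Cmod (f xi)) by now apply Cmod_gt_0.
  (* This choice gives [f xi] and [c * xi] equal moduli, which minimises the resulting bound,
     proportional to [(Cmod (f xi) + c * Cmod xi) ^ 2 / c]. *)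
  set (c := Cmod (f xi) / Cmod xi).
  assert (Hc : 0 < c) by now apply Rdiv_lt_0_compat.
  set (h := fun z => ((f z - c * z) / (f z + c * z))%C).
  assert (Hh : forall z, 0 < Re z -> (f z + c * z)%C <> 0 /\ Cmod (h z) <= 1).
  { intros z Hz; destruct (Cdiv_minus_plus_le_1 (f z / z)%C c Hc (Hre z Hz)) as [H1 H2].
    pose proof (nz z Hz) as Hz0.
    assert (E : (f z + c * z)%C = ((f z / z + c) * z)%C) by (field; assumption).
    assert (Hne : (f z + c * z)%C <> 0) by (rewrite E; now apply Cmult_neq_0).
    split; [assumption|]; unfold h.
    replace ((f z - c * z) / (f z + c * z))%C with ((f z / z - c) / (f z / z + c))%C; [assumption|].
    field; repeat split; assumption. }
  assert (Dh : forall z d, 0 < Re z -> C_is_derive f z d ->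
    C_is_derive h z (((d - c * 1) * (f z + c * z) - (f z - c * z) * (d + c * 1))
                     / ((f z + c * z) * (f z + c * z)))%C).
  { intros z d Hz Hd.
    apply (C_is_derive_div (fun z => f z - c * z)%C (fun z => f z + c * z)%C); [now apply Hh | |].
    - apply (C_is_derive_minus f (fun z => c * z)%C); [assumption|].
      apply (C_is_derive_scal c z (fun z => z)), C_is_derive_id.
    - apply (C_is_derive_plus f (fun z => c * z)%C); [assumption|].
      apply (C_is_derive_scal c z (fun z => z)), C_is_derive_id. }
  (* Half of [Re xi] as radius keeps the closed disc inside the half-plane. *)
  assert (near : forall z, Cmod (z - xi) <= Re xi / 2 -> 0 < Re z).
  { intros z Hz; pose proof (Rabs_Re_le_Cmod (z - xi)) as H.
    assert (E : Re (z - xi) = Re z - Re xi) by reflexivity.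
    rewrite E in H; apply Rabs_le_between in H; lra. }
  assert (HC := fun M => cauchy_estimate h xi _ (Re xi / 2) M ltac:(lra)
    ltac:(intros z Hz; destruct (Hhol z (near z Hz)) as [d Hd]; eexists; exact (Dh z d (near z Hz) Hd))
    (Dh xi df Hxi Hdf)).
  (* Two values of [h] lie in the closed unit disc, hence differ by at most 2. *)
  specialize (HC 2).
  destruct (Hh xi Hxi) as [Hne Hhxi].
  replace (((df - c * 1) * (f xi + c * xi) - (f xi - c * xi) * (df + c * 1))
           / ((f xi + c * xi) * (f xi + c * xi)))%C
    with (2 * c * (xi * df - f xi) / ((f xi + c * xi) * (f xi + c * xi)))%C in HC
    by (field; assumption).
  set (D := (xi * df - f xi)%C) in *.
  rewrite Cmod_div, !Cmod_mult, !Cmod_R in HC by now apply Cmult_neq_0.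
  rewrite !Rabs_pos_eq in HC by lra.
  assert (Hden : Cmod (f xi + c * xi) <= 2 * Cmod (f xi)).
  { eapply Rle_trans; [apply Cmod_triangle|].
    rewrite Cmod_mult, Cmod_R, Rabs_pos_eq by lra.
    replace (c * Cmod xi) with (Cmod (f xi)) by (unfold c; field; lra). lra. }
  assert (Hdpos : 0 < Cmod (f xi + c * xi)) by now apply Cmod_gt_0.
  set (N := Cmod (f xi + c * xi)) in *.
  assert (HC' : 2 * c * Cmod D / (N * N) <= 2 / (Re xi / 2)).
  { apply HC; intros z Hz.
    assert (Hz' : 0 < Re z) by (apply near; lra).
    destruct (Hh z Hz') as [_ Hhz].
    unfold Cminus; eapply Rle_trans; [apply Cmod_triangle|]; rewrite Cmod_opp; lra. }
  clear HC.
  set (F := Cmod (f xi)) in *; set (m := Cmod xi) in *; set (x := Re xi) in *.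
  apply Rmult_le_compat_r with (r := N * N) in HC'; [|nra].
  replace (2 * c * Cmod D / (N * N) * (N * N)) with (2 * c * Cmod D) in HC' by (field; lra).
  assert (Hx4 : 0 < 2 / (x / 2)) by (apply Rdiv_lt_0_compat; lra).
  assert (HN : N * N <= 4 * (F * F)) by nra.
  assert (H2 : 2 * c * Cmod D <= 2 / (x / 2) * (4 * (F * F))).
  { eapply Rle_trans; [exact HC'|]; apply Rmult_le_compat_l; lra. }
  apply Rmult_le_reg_l with (2 * c); [lra|].
  eapply Rle_trans; [exact H2|]; right; unfold c; field; lra.
Qed.

(** The value is chosen so that [4 * (1 + 5 / 4) = 9]. *)
Lemma five_fourths_le_sqrt_2 : 5 / 4 <= sqrt 2.
Proof. rewrite <- (sqrt_square (5 / 4)) by lra; apply sqrt_le_1_alt; lra. Qed.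

Theorem proposition6p8 :
  forall f : C -> C,
    rogers_function f ->
    (exists z : C, right_half_plane z /\ f z <> RtoC 0) ->
    forall xi : C,
      right_half_plane xi ->
      Cmod (xi * C_derive f xi / f xi)%C
        <= 4 * (1 + sqrt 2) * / (1 - Rabs (Im xi) / Cmod xi) * (Cmod xi / Re xi).
Proof.
  intros f Hf _ xi Hxi.
  assert (Hre : 0 < Re xi) by exact Hxi.
  assert (HmR : Re xi <= Cmod xi) by (eapply Rle_trans; [apply Rle_abs | apply Rabs_Re_le_Cmod]).
  assert (HmI : Rabs (Im xi) < Cmod xi).
  { unfold Cmod; rewrite <- sqrt_Rsqr_abs; apply sqrt_lt_1_alt.
    unfold Re, Im, Rsqr in *; nra. }
  set (T := Cmod xi / Re xi).
  assert (HT : 1 <= T).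
  { unfold T; apply Rmult_le_reg_r with (Re xi); [assumption|].
    unfold Rdiv; rewrite Rmult_assoc, Rinv_l; lra. }
  set (K := / (1 - Rabs (Im xi) / Cmod xi)).
  assert (HK : 1 <= K).
  { assert (0 <= Rabs (Im xi) / Cmod xi) by (apply Rdiv_le_0_compat; [apply Rabs_pos | lra]).
    assert (Rabs (Im xi) / Cmod xi < 1) by (apply Rlt_div_l; lra).
    unfold K; rewrite <- Rinv_1; apply Rinv_le_contravar; lra. }
  pose proof five_fourths_le_sqrt_2 as H2.
  (* The bound [9 * T] is stronger than the goal, since [K >= 1] and [9 <= 4 * (1 + sqrt 2)]. *)
  apply Rle_trans with (9 * T).
  2: { apply Rmult_le_compat_r; [lra | nra]. }
  destruct (Ceq_dec (f xi) 0) as [E|Hne].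
  - (* junk value: [x / 0 = 0] in [C] *)
    replace (xi * C_derive f xi / f xi)%C with (RtoC 0); [rewrite Cmod_0; lra|].
    rewrite E; apply injective_projections; simpl; unfold Rdiv; ring.
  - destruct Hf as [Hhol Hpos]; pose proof (C_derive_correct f xi 0 (Hhol xi Hxi)) as Hd.
    pose proof (rogers_derivative_bound f xi _ (conj Hhol Hpos) Hxi Hne Hd) as HB.
    fold T in HB; set (d := C_derive f xi) in *.
    assert (HF : 0 < Cmod (f xi)) by now apply Cmod_gt_0.
    rewrite Cmod_div by assumption.
    apply Rmult_le_reg_r with (Cmod (f xi)); [assumption|].
    unfold Rdiv; rewrite Rmult_assoc, Rinv_l, Rmult_1_r by lra.
    (* The triangle inequality gives the factor [8 * T + 1], at most [9 * T] because [T >= 1]. *)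
    replace (xi * d)%C with ((xi * d - f xi) + f xi)%C by ring.
    eapply Rle_trans; [apply Cmod_triangle|]; nra.
Qed.
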